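(* Let $M=\mathbb{T}\times[-1,1]$ and let $v\in C^2([-1,1])$ be a function that vanishes at only finitely many points of $[-1,1]$, all of them lying in $(-1,1)$, and such that $v''(y_i)\neq 0$ at each zero $y_i$ of $v$. Then any steady state $u\in C^2(M)$ of the Euler equations in $M$ that is sufficiently close in $C^2$ to the shear flow $(v(y),0)$ is itself a shear flow; that is, there exists $\varepsilon_0>0$ (depending on $v$) such that every steady Euler solution $u\in C^2(M)$ with $\|u-(v(y),0)\|_{C^2(M)}<\varepsilon_0$ is a shear flow.
   Context: A steady state of the Euler equations on $M$ is a velocity field $u$ such that, for some pressure $p$, $u\cdot\nabla u=-\nabla p$ and $\nabla\cdot u=0$ in $M$, and $u\cdot\hat n=0$ on $\partial M$. A shear flow is a field of the form $u(x,y)=(\tilde v(y),0)$. *)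

(* Defs.v *)
From Stdlib Require Import Reals.
From Coquelicot Require Import Coquelicot.
Open Scope R_scope.

(* The channel M = T x [-1,1], with T = R/LZ, is represented by its universal
   cover: a function on M is an f : R -> R -> R that is L-periodic in its first
   argument on the strip |y| <= 1.  Values outside the strip are irrelevant.

   For a set with boundary, C^n means: n times continuously differentiable in
   the interior, with all derivatives of order <= n extending continuously to
   the closed set (and the function itself continuous on the closed set). *)

Definition closed_channel (q : R * R) : Prop := -1 <= snd q <= 1.

Definition periodic_in_x (L : R) (f : R -> R -> R) : Prop :=
  forall x y, -1 <= y <= 1 -> f (x + L) y = f x y.

Definition Cn_interval (n : nat) (v : R -> R) : Prop :=
  continuous_on (fun y : R => -1 <= y <= 1) v /\
  forall k, (k <= n)%nat ->
    (forall y, -1 < y < 1 -> ex_derive_n v k y) /\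
    exists g : R -> R,
      continuous_on (fun y : R => -1 <= y <= 1) g /\
      forall y, -1 < y < 1 -> g y = Derive_n v k y.

Definition Cn_channel (n : nat) (L : R) (f : R -> R -> R) : Prop :=
  periodic_in_x L f /\
  continuous_on closed_channel (fun q : R * R => f (fst q) (snd q)) /\
  (forall x y, -1 < y < 1 -> ex_diff_n f n x y) /\
  forall m k, (m + k <= n)%nat ->
    exists g : R -> R -> R,
      continuous_on closed_channel (fun q : R * R => g (fst q) (snd q)) /\
      forall x y, -1 < y < 1 -> g x y = partial_derive m k f x y.

(* The supremum over the open channel equals the one over M for a C^2(M)
   function, by continuity of the extended derivatives. *)
Definition C2_norm (f : R -> R -> R) : Rbar :=
  Lub_Rbar (fun r => exists (m k : nat) (x y : R),
    (m + k <= 2)%nat /\ -1 < y < 1 /\ r = Rabs (partial_derive m k f x y)).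

Definition C2_norm_field (f1 f2 : R -> R -> R) : Rbar :=
  Rbar_plus (C2_norm f1) (C2_norm f2).

Definition d_x (f : R -> R -> R) (x y : R) : R := Derive (fun t => f t y) x.
Definition d_y (f : R -> R -> R) (x y : R) : R := Derive (fun t => f x t) y.

(* The equations are imposed at interior points; for C^2(M) velocities they
   extend to the boundary by continuity, and grad p, being equal to
   -(u . grad u), is automatically C^1 up to the boundary. *)
Definition steady_euler (L : R) (u1 u2 : R -> R -> R) : Prop :=
  (exists p : R -> R -> R,
     periodic_in_x L p /\
     forall x y, -1 < y < 1 ->
       is_derive (fun t => p t y) x
         (- (u1 x y * d_x u1 x y + u2 x y * d_y u1 x y)) /\
       is_derive (fun t => p x t) y
         (- (u1 x y * d_x u2 x y + u2 x y * d_y u2 x y))) /\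
  (forall x y, -1 < y < 1 -> d_x u1 x y + d_y u2 x y = 0) /\
  (forall x, u2 x (-1) = 0 /\ u2 x 1 = 0).

Definition shear_flow (u1 u2 : R -> R -> R) : Prop :=
  exists w : R -> R,
    forall x y, -1 <= y <= 1 -> u1 x y = w y /\ u2 x y = 0.

(* Main.v *)
(** Put [A = u1 grad u2 - u2 grad u1]; incompressibility makes it the rotated
    pressure gradient, so [div A = 0], that is [u1 lap u2 = u2 lap u1].  Where
    [v] is away from [0] we have [|u2| <= |u1|] trivially; near a zero of [v],
    [lap u1] is close to [v'' <> 0] and the identity again gives
    [|u2| <= |u1|].  Formally, testing [div A = 0] against [u2 / u1] yields
    [int u1^2 |grad (u2 / u1)|^2 = 0].  To justify this across [u1 = 0], the
    test function is multiplied by a cutoff in [u1] that blows up only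
    logarithmically; since [|A| <= C |u1|], the error stays bounded, which
    forces [A = 0].  Then [u . grad u2 = 0], so [int u2^2 dx] does not depend
    on [y] and vanishes because [u2 = 0] on the boundary. *)
Require Import Defs.
From Stdlib Require Import Reals List Lra Lia.
From Coquelicot Require Import Coquelicot.
Open Scope R_scope.

(** * Continuously differentiable functions on the open channel *)

(** The partial derivatives are explicit arguments, so that the divergence of a field built by the
    product and chain rules is a known expression. Nothing is asked at the boundary; decay there
    enters through separate bounds by the distance [Rmin (1 - y) (1 + y)]. *)
Definition C1_channel (f fx fy : R -> R -> R) : Prop :=
  forall x y, -1 < y < 1 ->
    is_derive (fun t => f t y) x (fx x y) /\
    is_derive (fun t => f x t) y (fy x y) /\
    continuity_2d_pt f x y /\ continuity_2d_pt fx x y /\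
    continuity_2d_pt fy x y.

Lemma continuity_2d_pt_swap (f : R -> R -> R) (x y : R) :
  continuity_2d_pt f x y -> continuity_2d_pt (fun u v => f v u) y x.
Proof.
  intros H eps; destruct (H eps) as [d Hd]; exists d; intros u v Hu Hv.
  now apply Hd.
Qed.

Lemma continuity_2d_pt_continuous_1 (f : R -> R -> R) (x y : R) :
  continuity_2d_pt f x y -> continuous (fun t => f t y) x.
Proof.
  intros H; apply continuity_pt_filterlim, continuity_pt_locally.
  intros eps; destruct (H eps) as [d Hd]; exists d; intros t Ht.
  apply Hd; [exact Ht|]. rewrite Rminus_eq_0, Rabs_R0; apply cond_pos.
Qed.

Lemma locally_2d_fst_snd (P : R -> R -> Prop) (x y : R) :
  (forall u v, -1 < v < 1 -> P u v) -> -1 < y < 1 -> locally_2d P x y.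
Proof.
  intros HP Hy.
  assert (Hd : 0 < Rmin (1 - y) (1 + y)) by (apply Rmin_case; lra).
  exists (mkposreal _ Hd); simpl; intros u v _ Hv; apply HP.
  pose proof (Rmin_l (1 - y) (1 + y)); pose proof (Rmin_r (1 - y) (1 + y)).
  apply Rabs_lt_between in Hv; lra.
Qed.

Lemma locally_channel (P : R -> Prop) (y : R) :
  (forall t, -1 < t < 1 -> P t) -> -1 < y < 1 -> locally y P.
Proof.
  intros HP Hy.
  assert (Hd : 0 < Rmin (1 - y) (1 + y)) by (apply Rmin_case; lra).
  exists (mkposreal _ Hd); simpl; intros t Ht; apply HP.
  change (Rabs (t - y) < Rmin (1 - y) (1 + y)) in Ht.
  pose proof (Rmin_l (1 - y) (1 + y)); pose proof (Rmin_r (1 - y) (1 + y)).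
  apply Rabs_lt_between in Ht; lra.
Qed.

(** * The divergence theorem on the channel and its consequences *)

Lemma ex_RInt_slice (f : R -> R -> R) (a b y : R) :
  (forall x, continuity_2d_pt f x y) -> ex_RInt (fun x => f x y) a b.
Proof.
  intros H; apply (ex_RInt_continuous (V := R_CompleteNormedModule)).
  intros z _; apply (continuity_2d_pt_continuous_1 f), H.
Qed.

(* The divergence theorem in differential form: the flux of [(H, G)] through
   the circle at height [y] changes at the rate of the integrated divergence,
   since the [H]-contributions at [a] and [a + L] cancel. *)
Lemma is_derive_flux (L a : R) (G Gx Gy H Hx Hy : R -> R -> R) :
  C1_channel G Gx Gy -> C1_channel H Hx Hy ->
  (forall x y, -1 < y < 1 -> H (x + L) y = H x y) ->
  forall y, -1 < y < 1 ->
  is_derive (fun s => RInt (fun x => G x s) a (a + L)) y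
    (RInt (fun x => Gy x y + Hx x y) a (a + L)).
Proof.
  intros HG HH Hper y Hy0.
  assert (EGy : ex_RInt (fun x => Gy x y) a (a + L))
    by (apply ex_RInt_slice; intros x; apply (HG x y Hy0)).
  assert (IH : is_RInt (fun x => Hx x y) a (a + L) 0).
  { replace 0 with (minus (H (a + L) y) (H a y))
      by (rewrite (Hper a y Hy0); apply (minus_eq_zero (H a y))).
    apply (is_RInt_derive (V := R_CompleteNormedModule) (fun t => H t y)).
    - intros x _; apply (HH x y Hy0).
    - intros x _; apply continuity_2d_pt_continuous_1, (HH x y Hy0). }
  replace (RInt (fun x => Gy x y + Hx x y) a (a + L))
    with (RInt (fun x => Derive (fun t => G x t) y) a (a + L)).
  - apply (is_derive_RInt_param (fun s x => G x s)).
    + apply locally_channel; [|exact Hy0].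
      intros s Hs t _; eexists; apply (HG t s Hs).
    + intros t _.
      apply (continuity_2d_pt_swap (fun v u => Derive (fun z => G v z) u)).
      apply continuity_2d_pt_ext_loc with Gy; [|apply (HG t y Hy0)].
      apply locally_2d_fst_snd; [|exact Hy0].
      intros u w Hw; symmetry; apply is_derive_unique, (HG u w Hw).
    + apply locally_channel; [|exact Hy0].
      intros s Hs; apply ex_RInt_slice; intros x; apply (HG x s Hs).
  - transitivity (RInt (fun x => Gy x y) a (a + L)).
    + apply RInt_ext; intros x _; apply is_derive_unique, (HG x y Hy0).
    + symmetry; apply is_RInt_unique.
      replace (RInt (fun x => Gy x y) a (a + L))
        with (plus (RInt (fun x => Gy x y) a (a + L)) 0) by apply Rplus_0_r.
      apply (is_RInt_plus (V := R_NormedModule)); [|exact IH].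
      now apply (RInt_correct (V := R_CompleteNormedModule)).
Qed.

Lemma RInt_lower_bound (f : R -> R) (a b m : R) :
  a <= b -> ex_RInt f a b -> (forall x, a < x < b -> m <= f x) ->
  m * (b - a) <= RInt f a b.
Proof.
  intros Hab Hf Hm.
  replace (m * (b - a)) with (RInt (fun _ => m) a b)
    by (rewrite RInt_const; unfold scal; simpl; unfold mult; simpl; ring).
  apply RInt_le; auto. apply ex_RInt_const.
Qed.

Lemma increment_lower_bound (f df : R -> R) (a b m : R) :
  a <= b -> (forall y, a <= y <= b -> is_derive f y (df y)) ->
  (forall y, a <= y <= b -> m <= df y) -> m * (b - a) <= f b - f a.
Proof.
  intros Hab Hd Hm.
  destruct (MVT_gen f a b df) as [c [Hc Ec]].
  - rewrite Rmin_left, Rmax_right by lra. intros x Hx; apply Hd; lra.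
  - rewrite Rmin_left, Rmax_right by lra. intros x Hx.
    apply continuity_pt_filterlim, (ex_derive_continuous f); eexists; now apply Hd.
  - rewrite Rmin_left, Rmax_right in Hc by lra.
    rewrite Ec; apply Rmult_le_compat_r; [lra|now apply Hm].
Qed.

(** The total divergence over a strip exhausting the channel equals the flux through its two edges,
    which tends to 0. The divergence is at least [- C] on an area [2 * L] and gains [m] on a box of
    area [4 * r ^ 2], so the gain cannot exceed [2 * C * L]. *)
Lemma flux_box_bound (L C M x0 y0 r m : R) (G Gx Gy H Hx Hy : R -> R -> R) :
  0 <= C -> 0 <= M -> 0 < r -> r <= L / 2 -> -1 < y0 - r -> y0 + r < 1 ->
  C1_channel G Gx Gy -> C1_channel H Hx Hy ->
  (forall x y, -1 < y < 1 -> H (x + L) y = H x y) ->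
  (forall x y, -1 < y < 1 -> Rabs (G x y) <= M * Rmin (1 - y) (1 + y)) ->
  (forall x y, -1 < y < 1 -> - C <= Gy x y + Hx x y) ->
  (forall x y, Rabs (x - x0) <= r -> Rabs (y - y0) <= r ->
     m - C <= Gy x y + Hx x y) ->
  4 * r ^ 2 * m <= 2 * C * L.
Proof.
  intros HC HM Hr HrL Hy1 Hy2 HG HH Hper HGb Hlow Hbox.
  (* The period window is centred at [x0]; since [r <= L / 2], the box does not wrap around. *)
  set (a := x0 - L / 2).
  set (Q := fun x y => Gy x y + Hx x y).
  set (I := fun s => RInt (fun x => G x s) a (a + L)).
  set (J := fun y => RInt (fun x => Q x y) a (a + L)).
  assert (HI : forall y, -1 < y < 1 -> is_derive I y (J y))
    by (intros y Hy'; now apply (is_derive_flux L a G Gx Gy H Hx Hy)).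
  assert (EQ : forall y b c, -1 < y < 1 -> ex_RInt (fun x => Q x y) b c).
  { intros y b c Hy'; apply ex_RInt_slice; intros x.
    apply continuity_2d_pt_plus; [apply (HG x y Hy')|apply (HH x y Hy')]. }
  assert (HJ : forall y, -1 < y < 1 -> - C * L <= J y).
  { intros y Hy'; replace L with (a + L - a) at 1 by ring.
    apply RInt_lower_bound; [lra|now apply EQ|]. intros x _; now apply Hlow. }
  assert (HJ2 : forall y, y0 - r <= y <= y0 + r -> 2 * r * m - C * L <= J y).
  { intros y Hy'. unfold J.
    rewrite <- (RInt_Chasles (fun x => Q x y) a (x0 - r)) by (apply EQ; lra).
    rewrite <- (RInt_Chasles (fun x => Q x y) (x0 - r) (x0 + r))
      by (apply EQ; lra).
    assert (H1 : - C * (x0 - r - a) <= RInt (fun x => Q x y) a (x0 - r)).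
    { apply RInt_lower_bound; [unfold a; lra|apply EQ; lra|].
      intros x _; apply Hlow; lra. }
    assert (H2 : (m - C) * (x0 + r - (x0 - r))
                 <= RInt (fun x => Q x y) (x0 - r) (x0 + r)).
    { apply RInt_lower_bound; [lra|apply EQ; lra|].
      intros x Hx'; apply Hbox; apply Rabs_le_between; lra. }
    assert (H3 : - C * (a + L - (x0 + r))
                 <= RInt (fun x => Q x y) (x0 + r) (a + L)).
    { apply RInt_lower_bound; [unfold a; lra|apply EQ; lra|].
      intros x _; apply Hlow; lra. }
    unfold plus; simpl.
    apply Rle_trans with (2 := Rplus_le_compat _ _ _ _ H1
                                 (Rplus_le_compat _ _ _ _ H2 H3)).
    right; ring. }
  assert (HIb : forall y, -1 < y < 1 ->
            Rabs (I y) <= M * Rmin (1 - y) (1 + y) * L).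
  { intros y Hy'. unfold I.
    replace (M * Rmin (1 - y) (1 + y) * L)
      with ((a + L - a) * (M * Rmin (1 - y) (1 + y))) by ring.
    apply (abs_RInt_le_const (fun x => G x y)); [lra| |].
    - apply ex_RInt_slice; intros x; apply (HG x y Hy').
    - intros t _; now apply HGb. }
  apply le_epsilon; intros e He.
  (* The strip is cut off at distance [d] from the walls: the first bound makes the two edge fluxes
     at most [e] together, the second keeps the box inside the strip. *)
  set (d := Rmin (e / (2 * (M * L + 1))) (Rmin (1 + (y0 - r)) (1 - (y0 + r)) / 2)).
  assert (HML : 0 <= M * L) by (apply Rmult_le_pos; lra).
  assert (Hdpos : 0 < d).
  { unfold d; apply Rmin_case.
    - apply Rdiv_lt_0_compat; lra.
    - apply Rmult_lt_0_compat; [apply Rmin_case|]; lra. }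
  assert (Hd1 : d * (2 * (M * L + 1)) <= e).
  { apply Rle_trans with (e / (2 * (M * L + 1)) * (2 * (M * L + 1))).
    - apply Rmult_le_compat_r; [lra|apply Rmin_l].
    - right; field; lra. }
  assert (Hd2 : d <= Rmin (1 + (y0 - r)) (1 - (y0 + r)) / 2) by apply Rmin_r.
  pose proof (Rmin_l (1 + (y0 - r)) (1 - (y0 + r))).
  pose proof (Rmin_r (1 + (y0 - r)) (1 - (y0 + r))).
  assert (K1 : - C * L * (y0 - r - (-1 + d)) <= I (y0 - r) - I (-1 + d)).
  { apply increment_lower_bound with J; [lra| |];
      intros y Hy'; [apply HI|apply HJ]; lra. }
  assert (K2 : (2 * r * m - C * L) * (y0 + r - (y0 - r)) <= I (y0 + r) - I (y0 - r)).
  { apply increment_lower_bound with J; [lra| |];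
      intros y Hy'; [apply HI|apply HJ2]; lra. }
  assert (K3 : - C * L * (1 - d - (y0 + r)) <= I (1 - d) - I (y0 + r)).
  { apply increment_lower_bound with J; [lra| |];
      intros y Hy'; [apply HI|apply HJ]; lra. }
  assert (B1 := HIb (1 - d) ltac:(lra)). assert (B2 := HIb (-1 + d) ltac:(lra)).
  rewrite Rmin_left in B1 by lra. rewrite Rmin_right in B2 by lra.
  apply Rabs_le_between in B1. apply Rabs_le_between in B2.
  assert (0 <= C * L) by (apply Rmult_le_pos; lra).
  nra.
Qed.

Lemma continuity_2d_pt_pos_box (f : R -> R -> R) (x y r0 : R) :
  0 < r0 -> continuity_2d_pt f x y -> 0 < f x y ->
  exists r, 0 < r <= r0 /\
    forall u v, Rabs (u - x) <= r -> Rabs (v - y) <= r -> f x y / 2 <= f u v.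
Proof.
  intros Hr0 Hf Hpos.
  destruct (Hf (mkposreal (f x y / 2) ltac:(lra))) as [d Hd]; simpl in Hd.
  pose proof (cond_pos d) as Hd0.
  exists (Rmin r0 (d / 2)); split.
  - split; [apply Rmin_case; lra|apply Rmin_l].
  - intros u v Hu Hv; pose proof (Rmin_r r0 (d / 2)).
    assert (H1 := Hd u v ltac:(lra) ltac:(lra)).
    apply Rabs_lt_between in H1; lra.
Qed.

(** This is [flux_box_bound] with [C = 0]: near a point of positive divergence there is a box where
    at least half of that value persists, and the bound then gives a contradiction. *)
Lemma nonneg_divergence_zero (L M : R) (G Gx Gy H Hx Hy : R -> R -> R) :
  0 < L -> 0 <= M -> C1_channel G Gx Gy -> C1_channel H Hx Hy ->
  (forall x y, -1 < y < 1 -> H (x + L) y = H x y) ->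
  (forall x y, -1 < y < 1 -> Rabs (G x y) <= M * Rmin (1 - y) (1 + y)) ->
  (forall x y, -1 < y < 1 -> 0 <= Gy x y + Hx x y) ->
  forall x y, -1 < y < 1 -> Gy x y + Hx x y = 0.
Proof.
  intros HL HM HG HH Hper HGb Hnn x y Hxy.
  apply Rle_antisym; [apply Rnot_lt_le; intros Hpos|now apply Hnn].
  assert (Hr0 : 0 < Rmin (L / 2) (Rmin (1 - y) (1 + y) / 2)).
  { apply Rmin_case; [lra|]. apply Rmult_lt_0_compat; [apply Rmin_case|]; lra. }
  destruct (continuity_2d_pt_pos_box (fun u v => Gy u v + Hx u v) x y _ Hr0)
    as [r [Hr Hbox]]; [|exact Hpos|].
  { apply continuity_2d_pt_plus; [apply (HG x y Hxy)|apply (HH x y Hxy)]. }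
  pose proof (Rmin_l (L / 2) (Rmin (1 - y) (1 + y) / 2)).
  pose proof (Rmin_r (L / 2) (Rmin (1 - y) (1 + y) / 2)).
  pose proof (Rmin_l (1 - y) (1 + y)).
  pose proof (Rmin_r (1 - y) (1 + y)).
  simpl in Hbox.
  assert (K := flux_box_bound L 0 M x y r ((Gy x y + Hx x y) / 2)
                 G Gx Gy H Hx Hy).
  assert (4 * r ^ 2 * ((Gy x y + Hx x y) / 2) <= 2 * 0 * L).
  { apply K; try assumption; try lra.
    - intros u v Hv. rewrite Ropp_0. now apply Hnn.
    - intros u v Hu Hv. rewrite Rminus_0_r. now apply Hbox. }
  assert (0 < r ^ 2) by (apply pow_lt; lra).
  nra.
Qed.

(** * Products, differences and compositions *)

Lemma C1_channel_mult (f fx fy g gx gy : R -> R -> R) :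
  C1_channel f fx fy -> C1_channel g gx gy ->
  C1_channel (fun x y => f x y * g x y)
    (fun x y => fx x y * g x y + f x y * gx x y)
    (fun x y => fy x y * g x y + f x y * gy x y).
Proof.
  intros Hf Hg x y Hy.
  destruct (Hf x y Hy) as (F1 & F2 & F3 & F4 & F5).
  destruct (Hg x y Hy) as (G1 & G2 & G3 & G4 & G5).
  split; [|split; [|split; [|split]]].
  - apply (is_derive_mult (fun t => f t y) (fun t => g t y) x); auto.
    intros a b; apply Rmult_comm.
  - apply (is_derive_mult (fun t => f x t) (fun t => g x t) y); auto.
    intros a b; apply Rmult_comm.
  - now apply continuity_2d_pt_mult.
  - apply continuity_2d_pt_plus; now apply continuity_2d_pt_mult.
  - apply continuity_2d_pt_plus; now apply continuity_2d_pt_mult.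
Qed.

Lemma C1_channel_minus (f fx fy g gx gy : R -> R -> R) :
  C1_channel f fx fy -> C1_channel g gx gy ->
  C1_channel (fun x y => f x y - g x y)
    (fun x y => fx x y - gx x y) (fun x y => fy x y - gy x y).
Proof.
  intros Hf Hg x y Hy.
  destruct (Hf x y Hy) as (F1 & F2 & F3 & F4 & F5).
  destruct (Hg x y Hy) as (G1 & G2 & G3 & G4 & G5).
  split; [|split; [|split; [|split]]]; try now apply continuity_2d_pt_minus.
  - now apply (is_derive_minus (fun t => f t y) (fun t => g t y) x).
  - now apply (is_derive_minus (fun t => f x t) (fun t => g x t) y).
Qed.

Lemma C1_channel_comp (h dh : R -> R) (f fx fy : R -> R -> R) :
  (forall s, is_derive h s (dh s)) -> (forall s, continuity_pt dh s) ->
  C1_channel f fx fy ->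
  C1_channel (fun x y => h (f x y))
    (fun x y => fx x y * dh (f x y)) (fun x y => fy x y * dh (f x y)).
Proof.
  intros Hh Hdh Hf x y Hy.
  destruct (Hf x y Hy) as (F1 & F2 & F3 & F4 & F5).
  split; [|split; [|split; [|split]]].
  - now apply (is_derive_comp h (fun t => f t y) x).
  - now apply (is_derive_comp h (fun t => f x t) y).
  - apply continuity_1d_2d_pt_comp; [|assumption].
    apply continuity_pt_filterlim, (ex_derive_continuous h); eexists; apply Hh.
  - apply continuity_2d_pt_mult; [assumption|].
    now apply continuity_1d_2d_pt_comp.
  - apply continuity_2d_pt_mult; [assumption|].
    now apply continuity_1d_2d_pt_comp.
Qed.

(** * The logarithmic cutoff *)

(* [s * cutoff n s] tends to infinity as [n -> oo] for [s <> 0] and vanishes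
   at [s = 0], but only at a logarithmic rate: its logarithmic derivative
   [s * d/ds] stays bounded uniformly in [n] (lemma [cutoff_scaling]). *)
Definition cutoff_slope (n s : R) : R := n * ln (1 + n * s ^ 2) / (1 + n * s ^ 2).
Definition cutoff (n s : R) : R := s * cutoff_slope n s.
(** The derivative of [cutoff n], arranged so that adding [cutoff_slope n s] cancels the last term;
    this sum is what appears in the error to be controlled. *)
Definition dcutoff (n s : R) : R :=
  2 * n * (ln (1 + n * s ^ 2) + n * s ^ 2) / (1 + n * s ^ 2) ^ 2 - cutoff_slope n s.

Lemma ns2_ge0 (n s : R) : 0 < n -> 0 <= n * s ^ 2.
Proof. intros Hn; apply Rmult_le_pos; [lra|apply pow2_ge_0]. Qed.

Lemma ln_1p_bounds (t : R) : 0 <= t -> 0 <= ln (1 + t) <= t.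
Proof.
  intros Ht; split.
  - rewrite <- ln_1. apply ln_le; lra.
  - rewrite <- (ln_exp t) at 2. apply ln_le; [lra|].
    apply exp_ineq1_le.
Qed.

Lemma is_derive_cutoff (n s : R) : 0 < n -> is_derive (cutoff n) s (dcutoff n s).
Proof.
  intros Hn; pose proof (ns2_ge0 n s Hn) as H.
  unfold cutoff, dcutoff, cutoff_slope.
  auto_derive; [repeat split; simpl in *; lra|].
  change (s * (s * 1)) with (s ^ 2); field; lra.
Qed.

Lemma continuity_pt_dcutoff (n s : R) : 0 < n -> continuity_pt (dcutoff n) s.
Proof.
  intros Hn; pose proof (ns2_ge0 n s Hn) as H.
  apply continuity_pt_filterlim, (ex_derive_continuous (dcutoff n)).
  unfold dcutoff, cutoff_slope.
  auto_derive; repeat split; simpl in *; try lra; apply Rgt_not_eq; nra.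
Qed.

Lemma cutoff_slope_ge0 (n s : R) : 0 < n -> 0 <= cutoff_slope n s.
Proof.
  intros Hn; pose proof (ns2_ge0 n s Hn) as H.
  apply Rdiv_le_0_compat; [|lra].
  apply Rmult_le_pos; [lra|now apply ln_1p_bounds].
Qed.

(** With [t = n * s ^ 2] and [l = ln (1 + t) <= t], the quantity is [2 * t * (l + t) / (1 + t) ^ 2],
    hence at most [4 * t ^ 2 / (1 + t) ^ 2], uniformly in [n]. *)
Lemma cutoff_scaling (n s : R) :
  0 < n -> Rabs (s ^ 2 * (cutoff_slope n s + dcutoff n s)) <= 4.
Proof.
  intros Hn; pose proof (ns2_ge0 n s Hn) as H.
  destruct (ln_1p_bounds _ H) as [H1 H2].
  unfold dcutoff. set (l := ln (1 + n * s ^ 2)) in *. set (t := n * s ^ 2) in *.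
  replace (s ^ 2 * _) with (2 * t * (l + t) / (1 + t) ^ 2)
    by (unfold t; field; fold t; lra).
  rewrite Rabs_pos_eq.
  - apply Rle_div_l; nra.
  - apply Rdiv_le_0_compat; nra.
Qed.

(** A crude bound growing with [n]; it only has to supply some finite flux constant [M], which does
    not enter the conclusion of [flux_box_bound]. *)
Lemma cutoff_abs_le (n s S : R) :
  0 < n -> Rabs s <= S -> Rabs (cutoff n s) <= S * (n * (n * S ^ 2)).
Proof.
  intros Hn Hs; pose proof (ns2_ge0 n s Hn) as H.
  destruct (ln_1p_bounds _ H) as [H1 H2].
  assert (Hs2 : s ^ 2 <= S ^ 2) by (apply pow_maj_Rabs; exact Hs).
  unfold cutoff; rewrite Rabs_mult, (Rabs_pos_eq (cutoff_slope n s))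
    by now apply cutoff_slope_ge0.
  apply Rmult_le_compat; [apply Rabs_pos|now apply cutoff_slope_ge0|exact Hs|].
  unfold cutoff_slope. apply Rle_div_l; [lra|].
  assert (n * s ^ 2 <= n * S ^ 2) by (apply Rmult_le_compat_l; lra).
  apply Rle_trans with (n * (n * S ^ 2)); [apply Rmult_le_compat_l; lra|].
  assert (0 <= n * (n * S ^ 2)) by (apply Rmult_le_pos; lra).
  nra.
Qed.

(** For [n >= 1] the factor [n / (1 + n * s ^ 2)] stays above [1 / (1 + S)], so the logarithm drives
    the slope to infinity with [n] wherever [s] is away from 0. *)
Lemma cutoff_slope_lower (n s a S : R) :
  1 <= n -> 0 < a -> a <= s ^ 2 <= S -> ln (1 + n * a) / (1 + S) <= cutoff_slope n s.
Proof.
  intros Hn Ha Hs. pose proof (ns2_ge0 n s ltac:(lra)) as H.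
  assert (Hl : ln (1 + n * a) <= ln (1 + n * s ^ 2)).
  { apply ln_le; [nra|]. apply Rplus_le_compat_l, Rmult_le_compat_l; lra. }
  assert (H0 : 0 <= ln (1 + n * a)) by (apply ln_1p_bounds; nra).
  unfold cutoff_slope. apply (Rle_div_r _ _ (1 + n * s ^ 2)); [lra|].
  replace (ln (1 + n * a) / (1 + S) * (1 + n * s ^ 2))
    with (ln (1 + n * a) * ((1 + n * s ^ 2) / (1 + S))) by (field; lra).
  rewrite (Rmult_comm n (ln (1 + n * s ^ 2))).
  apply Rmult_le_compat; try assumption.
  - apply Rdiv_le_0_compat; lra.
  - apply Rle_div_l; nra.
Qed.

(** * Vanishing of the Wronskian of the two velocity components *)

(** The condition [|w| <= |s|] lets the term [w * ds] be counted, like [s * dw], as of order [s]. *)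
Lemma wronskian_abs_le (s w ds dw B : R) :
  Rabs w <= Rabs s -> Rabs ds <= B -> Rabs dw <= B ->
  Rabs (s * dw - w * ds) <= 2 * B * Rabs s.
Proof.
  intros Hw Hds Hdw.
  apply Rle_trans with (1 := Rabs_triang _ _).
  rewrite Rabs_Ropp, !Rabs_mult.
  pose proof (Rabs_pos s); pose proof (Rabs_pos w); pose proof (Rabs_pos ds).
  assert (Rabs s * Rabs dw <= Rabs s * B) by (apply Rmult_le_compat_l; lra).
  assert (Rabs w * Rabs ds <= Rabs s * B) by (apply Rmult_le_compat; lra).
  lra.
Qed.

(* With [A = s grad w - w grad s], the divergence of [w * cutoff n s * A]
   (when [div A = 0]) is [cutoff_slope n s * |A|^2] up to an error which the
   logarithmic rate of the cutoff keeps bounded independently of [n]. *)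
Lemma cutoff_divergence_lower (n B s w sx sy wx wy : R) :
  0 < n -> Rabs w <= Rabs s -> Rabs sx <= B -> Rabs sy <= B ->
  Rabs wx <= B -> Rabs wy <= B ->
  cutoff_slope n s * ((s * wx - w * sx) ^ 2 + (s * wy - w * sy) ^ 2) - 16 * B ^ 2
  <= (wy * cutoff n s + w * (sy * dcutoff n s)) * (s * wy - w * sy)
     + (wx * cutoff n s + w * (sx * dcutoff n s)) * (s * wx - w * sx).
Proof.
  intros Hn Hw Hsx Hsy Hwx Hwy.
  assert (HAx := wronskian_abs_le s w sx wx B Hw Hsx Hwx).
  assert (HAy := wronskian_abs_le s w sy wy B Hw Hsy Hwy).
  assert (HB : 0 <= B) by (pose proof (Rabs_pos sx); lra).
  assert (Hk := cutoff_scaling n s Hn).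
  set (Ax := s * wx - w * sx) in *. set (Ay := s * wy - w * sy) in *.
  set (E := cutoff_slope n s + dcutoff n s) in *.
  (* Uses [cutoff n s = s * cutoff_slope n s] and [s grad w = A + w grad s], so the part along [A]
     becomes a square. *)
  match goal with |- _ <= ?r =>
    replace r with (cutoff_slope n s * (Ax ^ 2 + Ay ^ 2)
                    + w * E * (sx * Ax + sy * Ay)) end.
  2: unfold E, Ax, Ay, cutoff; ring.
  assert (HS : Rabs (sx * Ax + sy * Ay) <= 4 * B ^ 2 * Rabs s).
  { apply Rle_trans with (1 := Rabs_triang _ _). rewrite !Rabs_mult.
    assert (Rabs sx * Rabs Ax <= B * (2 * B * Rabs s))
      by (apply Rmult_le_compat; auto using Rabs_pos).
    assert (Rabs sy * Rabs Ay <= B * (2 * B * Rabs s))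
      by (apply Rmult_le_compat; auto using Rabs_pos).
    lra. }
  (* One factor [|s|] comes from [w] and one from [A]; together they form the [s ^ 2] that
     [cutoff_scaling] needs. *)
  assert (HE : Rabs (w * E * (sx * Ax + sy * Ay)) <= 16 * B ^ 2).
  { rewrite !Rabs_mult.
    apply Rle_trans with (Rabs s * Rabs E * (4 * B ^ 2 * Rabs s)).
    - apply Rmult_le_compat; auto using Rabs_pos.
      + apply Rmult_le_pos; apply Rabs_pos.
      + apply Rmult_le_compat_r; auto using Rabs_pos.
    - rewrite Rabs_mult, <- RPow_abs in Hk.
      replace (16 * B ^ 2) with (4 * B ^ 2 * 4) by ring.
      replace (_ * _ * _) with (4 * B ^ 2 * (Rabs s ^ 2 * Rabs E)) by ring.
      apply Rmult_le_compat_l; [|exact Hk].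
      pose proof (pow2_ge_0 B); lra. }
  apply Rabs_le_between in HE. lra.
Qed.

(** The field [w * cutoff n s * A], with [A = s grad w - w grad s], has divergence at least
    [-16 * B ^ 2] for every [n]. If [A] were nonzero at a point with [s] nonzero, the gain on a
    small box would grow like [ln n], against [flux_box_bound]. *)
Lemma wronskian_zero (L B : R)
  (s sx sy sxx sxy syx syy w wx wy wxx wxy wyx wyy : R -> R -> R) :
  0 < L -> C1_channel s sx sy -> C1_channel sx sxx sxy -> C1_channel sy syx syy ->
  C1_channel w wx wy -> C1_channel wx wxx wxy -> C1_channel wy wyx wyy ->
  (forall x y, -1 < y < 1 ->
     s (x + L) y = s x y /\ w (x + L) y = w x y /\
     sx (x + L) y = sx x y /\ wx (x + L) y = wx x y) ->
  (forall x y, -1 < y < 1 ->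
     Rabs (s x y) <= B /\ Rabs (sx x y) <= B /\ Rabs (sy x y) <= B /\
     Rabs (wx x y) <= B /\ Rabs (wy x y) <= B) ->
  (forall x y, -1 < y < 1 -> Rabs (w x y) <= Rabs (s x y)) ->
  (forall x y, -1 < y < 1 -> Rabs (w x y) <= B * Rmin (1 - y) (1 + y)) ->
  (forall x y, -1 < y < 1 ->
     s x y * (wxx x y + wyy x y) = w x y * (sxx x y + syy x y)) ->
  forall x y, -1 < y < 1 ->
    s x y * wx x y - w x y * sx x y = 0 /\ s x y * wy x y - w x y * sy x y = 0.
Proof.
  intros HL Hs Hsx Hsy Hw Hwx Hwy Hper HB Hws Hwb Heq x y Hxy.
  set (P := fun x y => (s x y * wx x y - w x y * sx x y) ^ 2
                     + (s x y * wy x y - w x y * sy x y) ^ 2).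
  assert (HP0 : forall u v, 0 <= P u v) by (intros; apply Rplus_le_le_0_compat; apply pow2_ge_0).
  cut (P x y = 0).
  { unfold P; intros E.
    pose proof (pow2_ge_0 (s x y * wx x y - w x y * sx x y)).
    pose proof (pow2_ge_0 (s x y * wy x y - w x y * sy x y)).
    split; apply Rsqr_0_uniq; unfold Rsqr; lra. }
  (* Where [s = 0], the domination [|w| <= |s|] gives [w = 0], and [A] vanishes trivially. *)
  destruct (Req_dec (s x y) 0) as [Hz|Hnz].
  { assert (Hw0 := Hws x y Hxy). rewrite Hz, Rabs_R0 in Hw0.
    assert (w x y = 0).
    { apply Rabs_eq_0, Rle_antisym; [exact Hw0|apply Rabs_pos]. }
    unfold P; rewrite Hz, H; ring. }
  apply Rle_antisym; [apply Rnot_lt_le; intros Hpos|apply HP0].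
  assert (Hs2 : 0 < s x y * s x y) by (apply Rsqr_pos_lt; exact Hnz).
  assert (Hr0 : 0 < Rmin (L / 2) (Rmin (1 - y) (1 + y) / 2)).
  { apply Rmin_case; [lra|]. apply Rmult_lt_0_compat; [apply Rmin_case|]; lra. }
  assert (Ax := C1_channel_minus _ _ _ _ _ _
                  (C1_channel_mult _ _ _ _ _ _ Hs Hwx)
                  (C1_channel_mult _ _ _ _ _ _ Hw Hsx)).
  assert (Ay := C1_channel_minus _ _ _ _ _ _
                  (C1_channel_mult _ _ _ _ _ _ Hs Hwy)
                  (C1_channel_mult _ _ _ _ _ _ Hw Hsy)).
  (* Two nested boxes: [s ^ 2 >= a] holds on the larger one, and also [P >= b] on the smaller
     one. *)
  destruct (continuity_2d_pt_pos_box (fun u v => s u v * s u v) x y _ Hr0)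
    as [r1 [Hr1 Hbox1]]; [|exact Hs2|].
  { apply continuity_2d_pt_mult; apply (Hs x y Hxy). }
  destruct (continuity_2d_pt_pos_box P x y _ (proj1 Hr1)) as [r [Hr Hbox]];
    [|exact Hpos|].
  { apply continuity_2d_pt_ext with
      (fun x y => (s x y * wx x y - w x y * sx x y) * (s x y * wx x y - w x y * sx x y)
       + (s x y * wy x y - w x y * sy x y) * (s x y * wy x y - w x y * sy x y)).
    - intros; unfold P; ring.
    - apply continuity_2d_pt_plus; apply continuity_2d_pt_mult;
        first [apply (Ax x y Hxy)|apply (Ay x y Hxy)]. }
  simpl in Hbox1.
  pose proof (Rmin_l (L / 2) (Rmin (1 - y) (1 + y) / 2)).
  pose proof (Rmin_r (L / 2) (Rmin (1 - y) (1 + y) / 2)).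
  pose proof (Rmin_l (1 - y) (1 + y)).
  pose proof (Rmin_r (1 - y) (1 + y)).
  set (a := s x y * s x y / 2) in *. set (b := P x y / 2) in *.
  assert (Ha : 0 < a) by (unfold a; lra). assert (Hb : 0 < b) by (unfold b; lra).
  assert (HB0 : 0 <= B).
  { destruct (HB x y Hxy) as [H' _]; pose proof (Rabs_pos (s x y)); lra. }
  assert (HB2 := pow2_ge_0 B).
  assert (Key : forall n, 1 <= n ->
            4 * r ^ 2 * (b * (ln (1 + n * a) / (1 + B ^ 2))) <= 2 * (16 * B ^ 2) * L).
  { intros n Hn. assert (Hn0 : 0 < n) by lra.
    assert (Hh := C1_channel_comp (cutoff n) (dcutoff n) _ _ _
                    (fun t => is_derive_cutoff n t Hn0)
                    (fun t => continuity_pt_dcutoff n t Hn0) Hs).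
    assert (HG := C1_channel_mult _ _ _ _ _ _ (C1_channel_mult _ _ _ _ _ _ Hw Hh) Ay).
    assert (HH := C1_channel_mult _ _ _ _ _ _ (C1_channel_mult _ _ _ _ _ _ Hw Hh) Ax).
    assert (Hlow : forall u v, -1 < v < 1 ->
              cutoff_slope n (s u v) * P u v - 16 * B ^ 2 <=
              (wy u v * cutoff n (s u v) + w u v * (sy u v * dcutoff n (s u v))) *
              (s u v * wy u v - w u v * sy u v) +
              w u v * cutoff n (s u v) *
              (sy u v * wy u v + s u v * wyy u v - (wy u v * sy u v + w u v * syy u v)) +
              ((wx u v * cutoff n (s u v) + w u v * (sx u v * dcutoff n (s u v))) *
               (s u v * wx u v - w u v * sx u v) +
               w u v * cutoff n (s u v) *
               (sx u v * wx u v + s u v * wxx u v - (wx u v * sx u v + w u v * sxx u v)))).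
    { intros u v Hv; destruct (HB u v Hv) as (_ & B1 & B2 & B3 & B4).
      assert (K := cutoff_divergence_lower n B (s u v) (w u v) (sx u v) (sy u v)
                     (wx u v) (wy u v) Hn0 (Hws u v Hv) B1 B2 B3 B4).
      fold (P u v) in K.
      (* The terms where [A] itself is differentiated: first-order products cancel, and what remains
         is [div A = 0]. *)
      assert (Hd : w u v * cutoff n (s u v) *
                   (s u v * (wxx u v + wyy u v) - w u v * (sxx u v + syy u v)) = 0)
        by (rewrite (Heq u v Hv); ring).
      lra. }
    (* The flux constant multiplies the bounds of three factors: [w] by [B] times the wall distance,
       the cutoff by [B * (n * (n * B ^ 2))], and the second component of [A] by [2 * B * B]. *)
    refine (flux_box_bound L (16 * B ^ 2) (B * (B * (n * (n * B ^ 2))) * (2 * B * B)) x y r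
              _ _ _ _ _ _ _ _ _ _ _ _ _ HG HH _ _ _ _); try lra.
    - repeat apply Rmult_le_pos; lra.
    - intros u v Hv; destruct (Hper u v Hv) as (-> & -> & -> & ->); reflexivity.
    - intros u v Hv; destruct (HB u v Hv) as (B0 & _ & B2 & _ & B4).
      rewrite !Rabs_mult.
      replace (_ * Rmin _ _)
        with (B * Rmin (1 - v) (1 + v) * (B * (n * (n * B ^ 2))) * (2 * B * B)) by ring.
      apply Rmult_le_compat;
        [apply Rmult_le_pos; apply Rabs_pos|apply Rabs_pos| |].
      + apply Rmult_le_compat; try apply Rabs_pos; [now apply Hwb|].
        now apply cutoff_abs_le.
      + apply Rle_trans with (1 := wronskian_abs_le _ _ _ _ B (Hws u v Hv) B2 B4).
        apply Rmult_le_compat_l; lra.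
    - intros u v Hv. apply Rle_trans with (2 := Hlow u v Hv).
      assert (0 <= cutoff_slope n (s u v) * P u v)
        by (apply Rmult_le_pos; [now apply cutoff_slope_ge0|apply HP0]).
      lra.
    - intros u v Hu Hv.
      assert (Hv' : -1 < v < 1) by (apply Rabs_le_between in Hv; lra).
      apply Rle_trans with (2 := Hlow u v Hv').
      apply Rplus_le_compat_r.
      rewrite Rmult_comm.
      apply Rmult_le_compat.
      + apply Rdiv_le_0_compat; [apply ln_1p_bounds; nra|lra].
      + lra.
      + apply cutoff_slope_lower; try assumption. split.
        * replace (s u v ^ 2) with (s u v * s u v) by ring. apply Hbox1; lra.
        * apply pow_maj_Rabs, (HB u v Hv').
      + now apply Hbox. }
  (* [Z] exceeds by 1 the ceiling that [Key] puts on [ln (1 + n * a)]; [n] is then taken large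
     enough to pass [Z]. *)
  set (Z := 2 * (16 * B ^ 2) * L / (4 * r ^ 2 * (b / (1 + B ^ 2))) + 1).
  assert (Hr2 : 0 < r ^ 2) by (apply pow_lt; lra).
  assert (HD : 0 < 4 * r ^ 2 * (b / (1 + B ^ 2))).
  { apply Rmult_lt_0_compat; [lra|apply Rdiv_lt_0_compat; lra]. }
  set (n := Rmax 1 (exp Z / a)).
  assert (HZ : Z < ln (1 + n * a)).
  { rewrite <- (ln_exp Z) at 1. apply ln_increasing; [apply exp_pos|].
    assert (exp Z / a <= n) by apply Rmax_r.
    apply Rle_div_l in H3; lra. }
  assert (K := Key n (Rmax_l _ _)).
  replace (4 * r ^ 2 * (b * (ln (1 + n * a) / (1 + B ^ 2))))
    with (ln (1 + n * a) * (4 * r ^ 2 * (b / (1 + B ^ 2)))) in K by (field; lra).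
  assert (K2 : Z * (4 * r ^ 2 * (b / (1 + B ^ 2)))
               <= 2 * (16 * B ^ 2) * L).
  { apply Rle_trans with (2 := K). apply Rmult_le_compat_r; lra. }
  apply (Rle_div_r _ _ _ HD) in K2. unfold Z in K2. lra.
Qed.

(** * Vanishing of the transverse velocity *)

Lemma C1_channel_const (c : R) :
  C1_channel (fun _ _ => c) (fun _ _ => 0) (fun _ _ => 0).
Proof.
  intros x y _; split; [|split; [|split; [|split]]];
    try apply continuity_2d_pt_const; apply (is_derive_const c).
Qed.

Lemma C1_channel_snd :
  C1_channel (fun _ y => y) (fun _ _ => 0) (fun _ _ => 1).
Proof.
  intros x y _; split; [|split; [|split; [|split]]];
    try apply continuity_2d_pt_const.
  - apply (is_derive_const y).
  - apply (is_derive_id y).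
  - apply continuity_2d_pt_id2.
Qed.

(* When [u . grad w = 0] for [u = (s, w)], momentum conservation makes
   [int w^2 dx] independent of [y]; the weight [y] turns this into a field
   [(y s w, y w^2)] of divergence [w^2 >= 0] and zero boundary flux. *)
Lemma transverse_velocity_zero (L B : R) (s sx sy w wx wy : R -> R -> R) :
  0 < L -> C1_channel s sx sy -> C1_channel w wx wy ->
  (forall x y, -1 < y < 1 -> s (x + L) y = s x y /\ w (x + L) y = w x y) ->
  (forall x y, -1 < y < 1 -> Rabs (w x y) <= B) ->
  (forall x y, -1 < y < 1 -> Rabs (w x y) <= B * Rmin (1 - y) (1 + y)) ->
  (forall x y, -1 < y < 1 -> sx x y + wy x y = 0) ->
  (forall x y, -1 < y < 1 -> s x y * wx x y + w x y * wy x y = 0) ->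
  forall x y, -1 < y < 1 -> w x y = 0.
Proof.
  intros HL Hs Hw Hper HB Hwb Hdiv Hadv x y Hy.
  assert (HG := C1_channel_mult _ _ _ _ _ _ C1_channel_snd
                  (C1_channel_mult _ _ _ _ _ _ Hw Hw)).
  assert (HH := C1_channel_mult _ _ _ _ _ _ C1_channel_snd
                  (C1_channel_mult _ _ _ _ _ _ Hs Hw)).
  assert (HB0 : 0 <= B) by (pose proof (HB x y Hy); pose proof (Rabs_pos (w x y)); lra).
  (* The left side is the divergence exactly as the product rule delivers it; incompressibility and
     [Hadv] reduce it to [w ^ 2]. *)
  assert (E : forall u v, -1 < v < 1 ->
            1 * (w u v * w u v) + v * (wy u v * w u v + w u v * wy u v)
            + (0 * (s u v * w u v) + v * (sx u v * w u v + s u v * wx u v))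
            = w u v * w u v).
  { intros u v Hv.
    replace (sx u v) with (- wy u v) by (pose proof (Hdiv u v Hv); lra).
    replace (s u v * wx u v) with (- (w u v * wy u v))
      by (pose proof (Hadv u v Hv); lra).
    ring. }
  apply Rsqr_0_uniq; unfold Rsqr; rewrite <- E by exact Hy.
  apply (nonneg_divergence_zero L (B * B) _ _ _ _ _ _ HL ltac:(nra) HG HH);
    [| | |exact Hy].
  - intros u v Hv; destruct (Hper u v Hv) as [-> ->]; reflexivity.
  - intros u v Hv. rewrite !Rabs_mult, Rmult_assoc.
    rewrite <- (Rmult_1_l (B * _)).
    apply Rmult_le_compat; [apply Rabs_pos|apply Rmult_le_pos; apply Rabs_pos| |].
    + apply Rabs_le_between; lra.
    + apply Rmult_le_compat; try apply Rabs_pos; [now apply HB|now apply Hwb].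
  - intros u v Hv; rewrite E by exact Hv; apply Rle_0_sqr.
Qed.

(** * The curl of the momentum equation *)

(** Schwarz's theorem for the pressure: [p] is only given with first partials, but these are the C1
    functions [P] and [Q], so the mixed partials exist and are continuous. *)
Lemma C1_gradient_symmetric (p P Px Py Q Qx Qy : R -> R -> R) :
  (forall x y, -1 < y < 1 -> is_derive (fun t => p t y) x (P x y) /\
                             is_derive (fun t => p x t) y (Q x y)) ->
  C1_channel P Px Py -> C1_channel Q Qx Qy ->
  forall x y, -1 < y < 1 -> Py x y = Qx x y.
Proof.
  intros Hp HP HQ x y Hy.
  assert (DP : forall u v, -1 < v < 1 -> Derive (fun t => p t v) u = P u v)
    by (intros u v Hv; now apply is_derive_unique, Hp).
  assert (DQ : forall u v, -1 < v < 1 -> Derive (fun t => p u t) v = Q u v)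
    by (intros u v Hv; now apply is_derive_unique, Hp).
  assert (DPy : forall u v, -1 < v < 1 ->
            is_derive (fun z => Derive (fun t => p t z) u) v (Py u v)).
  { intros u v Hv; apply is_derive_ext_loc with (fun z => P u z);
      [|apply (HP u v Hv)].
    apply locally_channel; [|exact Hv]. intros t Ht; symmetry; now apply DP. }
  assert (DQx : forall u v, -1 < v < 1 ->
            is_derive (fun z => Derive (fun t => p z t) v) u (Qx u v)).
  { intros u v Hv; apply is_derive_ext with (fun z => Q z v);
      [|apply (HQ u v Hv)]. intros t; symmetry; now apply DQ. }
  rewrite <- (is_derive_unique _ _ _ (DPy x y Hy)).
  rewrite <- (is_derive_unique _ _ _ (DQx x y Hy)).
  symmetry; apply Schwarz.
  - apply locally_2d_fst_snd; [|exact Hy]. intros u v Hv; repeat split; eexists.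
    + now apply Hp.
    + now apply Hp.
    + now apply DQx.
    + now apply DPy.
  - apply continuity_2d_pt_ext_loc with Qx; [|apply (HQ x y Hy)].
    apply locally_2d_fst_snd; [|exact Hy].
    intros u v Hv; symmetry; now apply is_derive_unique, DQx.
  - apply continuity_2d_pt_ext_loc with Py; [|apply (HP x y Hy)].
    apply locally_2d_fst_snd; [|exact Hy].
    intros u v Hv; symmetry; now apply is_derive_unique, DPy.
Qed.

Lemma Cn_channel_C1 (L : R) (f : R -> R -> R) :
  Cn_channel 2 L f ->
  C1_channel f (d_x f) (d_y f) /\
  C1_channel (d_x f) (d_x (d_x f)) (d_y (d_x f)) /\
  C1_channel (d_y f) (d_x (d_y f)) (d_y (d_y f)).
Proof.
  intros (_ & _ & H & _); split; [|split]; intros x y Hy;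
    destruct (H x y Hy) as (C & X & Y & (CX & XX & YX & (CXX & _) & (CYX & _))
                            & (CY & XY & YY & (CXY & _) & (CYY & _)));
    (split; [|split; [|split; [|split]]]); try assumption; now apply Derive_correct.
Qed.

(* The curl of the momentum equation, with the vorticity gradient rewritten
   through incompressibility. *)
Lemma steady_euler_laplacian (L : R) (u1 u2 : R -> R -> R) :
  Cn_channel 2 L u1 -> Cn_channel 2 L u2 -> steady_euler L u1 u2 ->
  forall x y, -1 < y < 1 ->
    u1 x y * (d_x (d_x u2) x y + d_y (d_y u2) x y)
    = u2 x y * (d_x (d_x u1) x y + d_y (d_y u1) x y).
Proof.
  intros H1 H2 ((p & _ & Hp) & Hdiv & _) x y Hy.
  destruct (Cn_channel_C1 L u1 H1) as (C1 & C1x & C1y).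
  destruct (Cn_channel_C1 L u2 H2) as (C2 & C2x & C2y).
  assert (HP := C1_channel_minus _ _ _ _ _ _
                  (C1_channel_minus _ _ _ _ _ _ (C1_channel_const 0)
                     (C1_channel_mult _ _ _ _ _ _ C1 C1x))
                  (C1_channel_mult _ _ _ _ _ _ C2 C1y)).
  assert (HQ := C1_channel_minus _ _ _ _ _ _
                  (C1_channel_minus _ _ _ _ _ _ (C1_channel_const 0)
                     (C1_channel_mult _ _ _ _ _ _ C1 C2x))
                  (C1_channel_mult _ _ _ _ _ _ C2 C2y)).
  assert (E := fun Hgrad => C1_gradient_symmetric p _ _ _ _ _ _ Hgrad HP HQ x y Hy).
  match type of E with ?T -> _ => assert (Hgrad : T) end.
  { intros a b Hb; destruct (Hp a b Hb) as [Da Db]; split.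
    - replace (0 - _ - _) with (- (u1 a b * d_x u1 a b + u2 a b * d_y u1 a b)) by ring.
      exact Da.
    - replace (0 - _ - _) with (- (u1 a b * d_x u2 a b + u2 a b * d_y u2 a b)) by ring.
      exact Db. }
  specialize (E Hgrad); clear Hgrad.
  simpl in E.
  (* Incompressibility differentiated in [y], and below in [x], trades the mixed derivatives for
     pure ones. *)
  assert (Exy : d_y (d_x u1) x y = - d_y (d_y u2) x y).
  { unfold d_y at 1. rewrite (Derive_ext_loc _ (fun t => - d_y u2 x t)).
    - apply Derive_opp.
    - apply locally_channel; [|exact Hy].
      intros t Ht; pose proof (Hdiv x t Ht); lra. }
  assert (Eyx : d_x (d_y u2) x y = - d_x (d_x u1) x y).
  { unfold d_x at 1. rewrite (Derive_ext _ (fun t => - d_x u1 t y)).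
    - apply Derive_opp.
    - intros t; pose proof (Hdiv t y Hy); lra. }
  rewrite Exy, Eyx in E.
  assert (Ed := Hdiv x y Hy).
  (* With this substitution the products of first derivatives cancel on each side, leaving only the
     Laplacian terms. *)
  replace (d_x u1 x y) with (- d_y u2 x y) in E by lra.
  lra.
Qed.

(** * Functions continuous on the closed interval *)

(** Composition with this projection extends a function continuous on the closed interval to the
    whole line, giving the two-sided continuity that the extreme and mean value theorems ask for at
    the endpoints. *)
Definition clamp (t : R) : R := Rmax (-1) (Rmin 1 t).

Lemma clamp_range (t : R) : -1 <= clamp t <= 1.
Proof. split; [apply Rmax_l|apply Rmax_lub; [lra|apply Rmin_l]]. Qed.

Lemma clamp_id (t : R) : -1 <= t <= 1 -> clamp t = t.
Proof.
  intros H; unfold clamp; rewrite Rmin_right by lra; apply Rmax_right; lra.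
Qed.

Lemma clamp_contract (s t : R) : Rabs (clamp s - clamp t) <= Rabs (s - t).
Proof.
  unfold clamp, Rmax, Rmin, Rabs.
  destruct (Rle_dec 1 s), (Rle_dec 1 t);
  repeat match goal with |- context [Rle_dec ?a ?b] => destruct (Rle_dec a b) end;
  repeat destruct Rcase_abs; lra.
Qed.

Lemma continuity_pt_clamp (f : R -> R) (t : R) :
  continuous_on (fun y : R => -1 <= y <= 1) f -> continuity_pt (fun s => f (clamp s)) t.
Proof.
  intros Hf; apply continuity_pt_filterlim.
  intros P HP; destruct (Hf (clamp t) (clamp_range t) P HP) as [e He].
  exists e; intros s Hs; apply He; [|apply clamp_range].
  apply Rle_lt_trans with (2 := Hs), clamp_contract.
Qed.

Lemma continuous_on_slice (f : R -> R -> R) (x : R) :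
  continuous_on closed_channel (fun q : R * R => f (fst q) (snd q)) ->
  continuous_on (fun y : R => -1 <= y <= 1) (f x).
Proof.
  intros Hf y Hy P HP; destruct (Hf (x, y) Hy P HP) as [e He].
  exists e; intros t Ht HI; apply (He (x, t)); [|exact HI].
  split; [apply ball_center|exact Ht].
Qed.

Lemma continuous_on_interval_min (f : R -> R) :
  continuous_on (fun y : R => -1 <= y <= 1) f ->
  exists c, -1 <= c <= 1 /\ forall y, -1 <= y <= 1 -> f c <= f y.
Proof.
  intros Hf.
  destruct (continuity_ab_min (fun s => f (clamp s)) (-1) 1) as [c [Hc1 Hc2]];
    [lra|intros; now apply continuity_pt_clamp|].
  exists c; split; [exact Hc2|]. intros y Hy.
  specialize (Hc1 y Hy). now rewrite !clamp_id in Hc1.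
Qed.

Lemma continuous_on_interval_bounded (f : R -> R) :
  continuous_on (fun y : R => -1 <= y <= 1) f ->
  exists V, forall y, -1 <= y <= 1 -> Rabs (f y) <= V.
Proof.
  intros Hf.
  destruct (continuous_on_interval_min (fun y => - Rabs (f y))) as [c [_ Hc]].
  - intros y Hy.
    apply (filterlim_comp _ _ _ _ (fun t => - Rabs t) _ (locally (f y))); [now apply Hf|].
    apply (continuous_opp (fun t => Rabs t)), continuous_Rabs.
  - exists (Rabs (f c)); intros y Hy; specialize (Hc y Hy); lra.
Qed.

Lemma eq_on_closure (f g : R -> R) :
  continuous_on (fun y : R => -1 <= y <= 1) f ->
  continuous_on (fun y : R => -1 <= y <= 1) g ->
  (forall y, -1 < y < 1 -> f y = g y) ->
  forall y, -1 <= y <= 1 -> f y = g y.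
Proof.
  intros Hf Hg Heq y Hy.
  apply Rminus_diag_uniq, cond_eq; intros e He.
  assert (C : continuity_pt (fun s => f (clamp s) - g (clamp s)) y)
    by (apply continuity_pt_minus; now apply continuity_pt_clamp).
  apply continuity_pt_locally with (eps := mkposreal e He) in C.
  destruct C as [d Hd]; simpl in Hd.
  set (h := Rmin (1 / 2) (d / 2)).
  pose proof (cond_pos d).
  assert (Hh : 0 < h) by (apply Rmin_case; lra).
  assert (Hh1 : h <= 1 / 2) by apply Rmin_l.
  assert (Hh2 : h <= d / 2) by apply Rmin_r.
  (* The point [y] is moved by [h] towards the middle; [h <= 1 / 2] keeps it in the open
     interval. *)
  assert (Hz : exists z, -1 < z < 1 /\ Rabs (z - y) < d).
  { destruct (Rle_dec y 0).
    - exists (y + h); split; [lra|]. apply Rabs_lt_between; lra.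
    - exists (y - h); split; [lra|]. apply Rabs_lt_between; lra. }
  destruct Hz as [z [Hz1 Hz2]].
  specialize (Hd z Hz2); rewrite !clamp_id in Hd by lra.
  rewrite (Heq z Hz1), Rminus_eq_0, Rminus_0_l, Rabs_Ropp in Hd.
  now rewrite Rminus_0_r.
Qed.

(** The mean value theorem is applied between [y] and each wall, where [f] vanishes. *)
Lemma boundary_distance_bound (f df : R -> R) (B : R) :
  continuous_on (fun y : R => -1 <= y <= 1) f ->
  (forall y, -1 < y < 1 -> is_derive f y (df y)) ->
  (forall y, -1 < y < 1 -> Rabs (df y) <= B) ->
  f (-1) = 0 -> f 1 = 0 ->
  forall y, -1 < y < 1 -> Rabs (f y) <= B * Rmin (1 - y) (1 + y).
Proof.
  intros Hc Hd HB Hm Hp y Hy.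
  assert (HB0 : 0 <= B) by (pose proof (HB y Hy); pose proof (Rabs_pos (df y)); lra).
  (* The mean value point may be returned as an endpoint, where [df] is not controlled; truncating
     to [[-B, B]] changes nothing inside and gives the bound everywhere. *)
  set (df' := fun t => Rmax (- B) (Rmin B (df t))).
  assert (D : forall t, -1 < t < 1 -> is_derive (fun s => f (clamp s)) t (df' t)).
  { intros t Ht. apply is_derive_ext_loc with f.
    - apply locally_channel; [|exact Ht]. intros s Hs; rewrite clamp_id; lra.
    - assert (H := HB t Ht); apply Rabs_le_between in H.
      unfold df'; rewrite Rmin_right, Rmax_right by (try apply Rmin_glb; lra).
      now apply Hd. }
  assert (K : forall a b, -1 <= a -> a < b -> b <= 1 ->
            Rabs (f b - f a) <= B * (b - a)).
  { intros a b Ha Hab Hb.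
    destruct (MVT_gen (fun s => f (clamp s)) a b df') as [c [_ Ec]].
    { rewrite Rmin_left, Rmax_right by lra; intros t Ht; apply D; lra. }
    { intros t _; now apply continuity_pt_clamp. }
    rewrite !clamp_id in Ec by lra.
    rewrite Ec, Rabs_mult, (Rabs_pos_eq (b - a)) by lra.
    apply Rmult_le_compat_r; [lra|]. apply Rabs_le_between; split.
    - apply Rmax_l.
    - apply Rmax_lub; [lra|apply Rmin_l]. }
  assert (K1 := K y 1 ltac:(lra) ltac:(lra) ltac:(lra)).
  assert (K2 := K (-1) y ltac:(lra) ltac:(lra) ltac:(lra)).
  rewrite Hp, Rminus_0_l, Rabs_Ropp in K1. rewrite Hm, Rminus_0_r in K2.
  apply Rmin_case; lra.
Qed.

(** * Periodicity and pointwise consequences of the C2 norm *)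

Lemma Derive_periodic (f : R -> R) (L x : R) :
  (forall t, f (t + L) = f t) -> Derive f (x + L) = Derive f x.
Proof.
  intros H; unfold Derive; f_equal; apply Lim_ext; intros h.
  replace (x + L + h) with (x + h + L) by ring. now rewrite !H.
Qed.

Lemma C2_norm_ge (f : R -> R -> R) (m k : nat) (x y : R) :
  (m + k <= 2)%nat -> -1 < y < 1 ->
  Rbar_le (Rabs (partial_derive m k f x y)) (C2_norm f).
Proof.
  intros Hmk Hy; apply (proj1 (Lub_Rbar_correct _)); now exists m, k, x, y.
Qed.

Lemma C2_norm_field_lt (f1 f2 : R -> R -> R) (e : R) :
  Rbar_lt (C2_norm_field f1 f2) e ->
  forall m k x y, (m + k <= 2)%nat -> -1 < y < 1 ->
    Rabs (partial_derive m k f1 x y) <= e /\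
    Rabs (partial_derive m k f2 x y) <= e.
Proof.
  unfold C2_norm_field; intros He m k x y Hmk Hy.
  assert (N1 := C2_norm_ge f1 m k x y Hmk Hy).
  assert (N2 := C2_norm_ge f2 m k x y Hmk Hy).
  pose proof (Rabs_pos (partial_derive m k f1 x y)).
  pose proof (Rabs_pos (partial_derive m k f2 x y)).
  (* [Rbar_plus] sends opposite infinities to 0, but [N1] and [N2] rule out minus infinity; for
     finite norms, each is nonnegative and so at most the sum. *)
  destruct (C2_norm f1) as [a| |]; destruct (C2_norm f2) as [b| |];
    simpl in *; try contradiction; lra.
Qed.

Lemma partial_derivatives_sub_shear (u : R -> R -> R) (v : R -> R) (e : R) :
  C1_channel u (d_x u) (d_y u) -> C1_channel (d_y u) (d_x (d_y u)) (d_y (d_y u)) ->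
  (forall y, -1 < y < 1 -> ex_derive v y /\ ex_derive (Derive v) y) ->
  (forall m k x y, (m + k <= 2)%nat -> -1 < y < 1 ->
    Rabs (partial_derive m k (fun x y => u x y - v y) x y) <= e) ->
  forall x y, -1 < y < 1 ->
    Rabs (u x y - v y) <= e /\ Rabs (d_x u x y) <= e /\
    Rabs (d_y u x y - Derive v y) <= e /\ Rabs (d_x (d_x u) x y) <= e /\
    Rabs (d_y (d_y u) x y - Derive_n v 2 y) <= e.
Proof.
  intros Hu Huy Hv H x y Hy.
  assert (Ex : forall x', Derive (fun t => u t y - v y) x' = d_x u x' y).
  { intros x'. rewrite Derive_minus.
    - rewrite Derive_const; apply Rminus_0_r.
    - eexists; apply (Hu x' y Hy).
    - apply ex_derive_const. }
  assert (Ey : forall y', -1 < y' < 1 ->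
            Derive (fun t => u x t - v t) y' = d_y u x y' - Derive v y').
  { intros y' Hy'. apply Derive_minus; [eexists; apply (Hu x y' Hy')|now apply Hv]. }
  split; [|split; [|split; [|split]]].
  - apply (H 0%nat 0%nat x y); [lia|exact Hy].
  - rewrite <- Ex. apply (H 1%nat 0%nat x y); [lia|exact Hy].
  - rewrite <- Ey by exact Hy. apply (H 0%nat 1%nat x y); [lia|exact Hy].
  - replace (d_x (d_x u) x y)
      with (Derive (fun x' => Derive (fun t => u t y - v y) x') x)
      by now apply Derive_ext.
    apply (H 2%nat 0%nat x y); [lia|exact Hy].
  - replace (d_y (d_y u) x y - Derive_n v 2 y)
      with (Derive (fun y' => Derive (fun t => u x t - v t) y') y).
    + apply (H 0%nat 2%nat x y); [lia|exact Hy].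
    + rewrite (Derive_ext_loc _ (fun y' => d_y u x y' - Derive v y'))
        by (apply locally_channel; [exact Ey|exact Hy]).
      apply Derive_minus; [eexists; apply (Huy x y Hy)|now apply Hv].
Qed.

(** * Nondegenerate profiles and domination of the transverse velocity *)

(** The sum, with the second derivative replaced by its continuous extension [g], attains its
    minimum on the compact interval. That minimum is positive: a zero of [v] is interior, and there
    [g] is the nonzero second derivative. *)
Lemma nondegenerate_profile (v : R -> R) :
  Cn_interval 2 v ->
  (forall y, -1 <= y <= 1 -> v y = 0 -> -1 < y < 1) ->
  (forall y, -1 < y < 1 -> v y = 0 -> Derive_n v 2 y <> 0) ->
  exists m, 0 < m /\
    forall y, -1 < y < 1 -> m <= Rabs (v y) + Rabs (Derive_n v 2 y).
Proof.
  intros [Hv0 Hvk] hint hv2.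
  destruct (Hvk 2%nat ltac:(lia)) as [_ [g [Hg Eg]]].
  destruct (continuous_on_interval_min (fun y => Rabs (v y) + Rabs (g y)))
    as [c [Hc Hmin]].
  { intros y Hy.
    apply (filterlim_comp_2 (F := within (fun y => -1 <= y <= 1) (locally y))
             (G := locally (Rabs (v y))) (H := locally (Rabs (g y)))
             (fun y => Rabs (v y)) (fun y => Rabs (g y)) Rplus).
    - apply filterlim_comp with (locally (v y)); [now apply Hv0|apply continuous_Rabs].
    - apply filterlim_comp with (locally (g y)); [now apply Hg|apply continuous_Rabs].
    - apply (filterlim_plus (V := R_NormedModule)). }
  exists (Rabs (v c) + Rabs (g c)); split.
  - pose proof (Rabs_pos (v c)); pose proof (Rabs_pos (g c)).
    destruct (Req_dec (v c) 0) as [Z|NZ].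
    + assert (Hc' := hint c Hc Z). rewrite (Eg c Hc').
      pose proof (Rabs_pos_lt _ (hv2 c Hc' Z)); lra.
    + pose proof (Rabs_pos_lt _ NZ); lra.
  - intros y Hy; rewrite <- Eg by exact Hy; apply Hmin; lra.
Qed.

Lemma profile_bounded (v : R -> R) :
  Cn_interval 2 v ->
  exists V, forall y, -1 < y < 1 -> Rabs (v y) <= V /\ Rabs (Derive v y) <= V.
Proof.
  intros [Hv0 Hvk].
  destruct (Hvk 1%nat ltac:(lia)) as [_ [g [Hg Eg]]].
  destruct (continuous_on_interval_bounded v Hv0) as [V0 H0].
  destruct (continuous_on_interval_bounded g Hg) as [V1 H1].
  exists (Rmax V0 V1); intros y Hy; split.
  - apply Rle_trans with V0; [apply H0; lra|apply Rmax_l].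
  - apply Rle_trans with V1; [|apply Rmax_r].
    change (Derive v y) with (Derive_n v 1 y).
    rewrite <- Eg by exact Hy; apply H1; lra.
Qed.

(* Either [|s|] is bounded below by the size of [w], or [lap s], being close to
   the nonzero [v''], is bounded below by the size of [lap w]. *)
Lemma abs_le_of_laplacians (m v v2 s sxx syy w wxx wyy : R) :
  0 < m -> m <= Rabs v + Rabs v2 ->
  Rabs (s - v) <= m / 8 -> Rabs sxx <= m / 8 -> Rabs (syy - v2) <= m / 8 ->
  Rabs w <= m / 8 -> Rabs wxx <= m / 8 -> Rabs wyy <= m / 8 ->
  s * (wxx + wyy) = w * (sxx + syy) ->
  Rabs w <= Rabs s.
Proof.
  intros Hm Hv Hs Hsx Hsy Hw Hwx Hwy E.
  (* If [|v| >= m / 2], then [|s| >= 3 * m / 8], above [|w|]. Otherwise [|v2| > m / 2], so the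
     Laplacian of [s] is at least [m / 4], which bounds that of [w]. *)
  destruct (Rle_lt_dec (m / 2) (Rabs v)) as [Hv1|Hv1].
  - pose proof (Rabs_triang_inv v (v - s)) as T.
    replace (v - (v - s)) with s in T by ring.
    rewrite (Rabs_minus_sym v s) in T. lra.
  - apply (f_equal Rabs) in E; rewrite !Rabs_mult in E.
    assert (H1 : Rabs (wxx + wyy) <= m / 4)
      by (apply Rle_trans with (1 := Rabs_triang _ _); lra).
    assert (H2 : m / 4 <= Rabs (sxx + syy)).
    { pose proof (Rabs_triang_inv v2 (v2 - (sxx + syy))) as T.
      replace (v2 - (v2 - (sxx + syy))) with (sxx + syy) in T by ring.
      assert (Rabs (v2 - (sxx + syy)) <= m / 4); [|lra].
      replace (v2 - (sxx + syy)) with (- (sxx + (syy - v2))) by ring.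
      rewrite Rabs_Ropp. apply Rle_trans with (1 := Rabs_triang _ _); lra. }
    apply Rmult_le_reg_r with (m / 4); [lra|].
    apply Rle_trans with (Rabs w * Rabs (sxx + syy));
      [apply Rmult_le_compat_l; auto using Rabs_pos|].
    rewrite <- E. apply Rmult_le_compat_l; auto using Rabs_pos.
Qed.

(** * Rigidity of steady states near the shear *)

(** Incompressibility leaves [d_x u1 = 0] inside, so [u1] agrees there with its slice at [x = 0];
    continuity carries this to the walls. *)
Lemma shear_flow_of_transverse_zero (L : R) (u1 u2 : R -> R -> R) :
  Cn_channel 2 L u1 -> steady_euler L u1 u2 ->
  (forall x y, -1 < y < 1 -> u2 x y = 0) -> shear_flow u1 u2.
Proof.
  intros H1 (_ & Hdiv & Hb) Hz.
  destruct (Cn_channel_C1 L u1 H1) as (C1 & _).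
  destruct H1 as (_ & Hc & _).
  exists (u1 0); intros x y Hy; split.
  - revert y Hy; apply eq_on_closure; try now apply continuous_on_slice.
    intros y Hy.
    assert (D : forall t, is_derive (fun t => u1 t y) t 0).
    { intros t; replace 0 with (d_x u1 t y); [apply (C1 t y Hy)|].
      assert (Dy : d_y u2 t y = 0).
      { unfold d_y; rewrite (Derive_ext_loc _ (fun _ => 0)); [apply Derive_const|].
        apply locally_channel; [|exact Hy]. intros s Hs; now apply Hz. }
      pose proof (Hdiv t y Hy); lra. }
    destruct (MVT_gen (fun t => u1 t y) 0 x (fun _ => 0)) as [c [_ Ec]];
      [intros; apply D| |lra].
    intros t _; apply continuity_pt_filterlim, (ex_derive_continuous (fun t => u1 t y)).
    eexists; apply D.
  - destruct (Hb x) as [Hb1 Hb2].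
    destruct (Req_dec y (-1)) as [->|N1]; [exact Hb1|].
    destruct (Req_dec y 1) as [->|N2]; [exact Hb2|].
    apply Hz; lra.
Qed.

Theorem theorem1p2 (L : R) (hL : 0 < L) (v : R -> R)
  (hv : Cn_interval 2 v)
  (hfin : exists l : list R, forall y, -1 <= y <= 1 -> v y = 0 -> In y l)
  (hint : forall y, -1 <= y <= 1 -> v y = 0 -> -1 < y < 1)
  (hv2 : forall y, -1 < y < 1 -> v y = 0 -> Derive_n v 2 y <> 0) :
  exists eps0 : R, 0 < eps0 /\
    forall u1 u2 : R -> R -> R,
      Cn_channel 2 L u1 -> Cn_channel 2 L u2 ->
      steady_euler L u1 u2 ->
      Rbar_lt (C2_norm_field (fun x y => u1 x y - v y) (fun x y => u2 x y - 0))
              (Finite eps0) ->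
      shear_flow u1 u2.
Proof.
  destruct (nondegenerate_profile v hv hint hv2) as [m [Hm Hmv]].
  destruct (profile_bounded v hv) as [V HV].
  (* The tolerance [m / 8] is the one under which [abs_le_of_laplacians] applies. *)
  exists (m / 8); split; [lra|]. intros u1 u2 H1 H2 HE Hclose.
  assert (Heq := steady_euler_laplacian L u1 u2 H1 H2 HE).
  destruct (Cn_channel_C1 L u1 H1) as (C1 & C1x & C1y).
  destruct (Cn_channel_C1 L u2 H2) as (C2 & C2x & C2y).
  assert (N := C2_norm_field_lt _ _ _ Hclose).
  assert (hvd : forall y, -1 < y < 1 -> ex_derive v y /\ ex_derive (Derive v) y).
  { intros y Hy; split;
      [apply (proj2 hv 1%nat ltac:(lia))|apply (proj2 hv 2%nat ltac:(lia))]; exact Hy. }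
  assert (N1 := partial_derivatives_sub_shear u1 v (m / 8) C1 C1y hvd
                  (fun i j x y h Hy => proj1 (N i j x y h Hy))).
  assert (N2 : forall x y, -1 < y < 1 ->
            Rabs (u2 x y) <= m / 8 /\ Rabs (d_x u2 x y) <= m / 8 /\
            Rabs (d_y u2 x y) <= m / 8 /\ Rabs (d_x (d_x u2) x y) <= m / 8 /\
            Rabs (d_y (d_y u2) x y) <= m / 8).
  { intros x y Hy.
    (* The component [u2] is treated as a perturbation of the zero profile. *)
    assert (K := partial_derivatives_sub_shear u2 (fun _ => 0) (m / 8) C2 C2y).
    destruct (K (fun y _ => conj (ex_derive_const 0 y)
                   (ex_derive_ext (fun _ => 0) _ y
                      (fun t => eq_sym (Derive_const 0 t)) (ex_derive_const 0 y)))
                (fun i j x y h Hy => proj2 (N i j x y h Hy)) x y Hy)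
      as (K0 & K1 & K2 & K3 & K4).
    rewrite Rminus_0_r in K0. rewrite Derive_const, Rminus_0_r in K2.
    rewrite Derive_n_const, Rminus_0_r in K4 by lia. now repeat split. }
  assert (Hle : forall x y, -1 < y < 1 -> Rabs (u2 x y) <= Rabs (u1 x y)).
  { intros x y Hy.
    destruct (N1 x y Hy) as (A0 & A1 & A2 & A3 & A4).
    destruct (N2 x y Hy) as (B0 & B1 & B2 & B3 & B4).
    exact (abs_le_of_laplacians m (v y) (Derive_n v 2 y) _ _ _ _ _ _ Hm (Hmv y Hy)
             A0 A3 A4 B0 B3 B4 (Heq x y Hy)). }
  pose proof HE as (_ & Hdiv & Hbdry).
  assert (Hper : forall x y, -1 < y < 1 ->
            u1 (x + L) y = u1 x y /\ u2 (x + L) y = u2 x y /\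
            d_x u1 (x + L) y = d_x u1 x y /\ d_x u2 (x + L) y = d_x u2 x y).
  { intros x y Hy. destruct H1 as (P1 & _). destruct H2 as (P2 & _).
    split; [|split; [|split]].
    - apply P1; lra.
    - apply P2; lra.
    - apply (Derive_periodic (fun t => u1 t y)); intros t; apply P1; lra.
    - apply (Derive_periodic (fun t => u2 t y)); intros t; apply P2; lra. }
  assert (Hwb : forall x y, -1 < y < 1 ->
            Rabs (u2 x y) <= (V + m / 8) * Rmin (1 - y) (1 + y)).
  { intros x y Hy.
    apply Rle_trans with (m / 8 * Rmin (1 - y) (1 + y)).
    - apply (boundary_distance_bound (u2 x) (d_y u2 x)); try apply Hbdry; try exact Hy.
      + apply continuous_on_slice, H2.
      + intros t Ht; apply (C2 x t Ht).
      + intros t Ht; apply (N2 x t Ht).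
    - apply Rmult_le_compat_r; [apply Rmin_case; lra|].
      pose proof (proj1 (HV y Hy)); pose proof (Rabs_pos (v y)); lra. }
  assert (HB : forall x y, -1 < y < 1 ->
            Rabs (u1 x y) <= V + m / 8 /\ Rabs (d_x u1 x y) <= V + m / 8 /\
            Rabs (d_y u1 x y) <= V + m / 8 /\
            Rabs (d_x u2 x y) <= V + m / 8 /\ Rabs (d_y u2 x y) <= V + m / 8).
  { intros x y Hy.
    destruct (N1 x y Hy) as (A0 & A1 & A2 & _).
    destruct (N2 x y Hy) as (_ & B1 & B2 & _).
    destruct (HV y Hy) as [V0 V1].
    pose proof (Rabs_triang_inv (u1 x y) (v y)).
    pose proof (Rabs_triang_inv (d_y u1 x y) (Derive v y)).
    pose proof (Rabs_pos (v y)). repeat split; lra. }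
  assert (HW := wronskian_zero L (V + m / 8) _ _ _ _ _ _ _ _ _ _ _ _ _ _
                  hL C1 C1x C1y C2 C2x C2y Hper HB Hle Hwb Heq).
  apply (shear_flow_of_transverse_zero L); try assumption.
  apply (transverse_velocity_zero L (V + m / 8) _ _ _ _ _ _ hL C1 C2); try assumption.
  - intros x y Hy; split; now apply Hper.
  - intros x y Hy; apply Rle_trans with (1 := Hle x y Hy); now apply HB.
  - intros x y Hy; destruct (HW x y Hy) as [W _].
    replace (d_y u2 x y) with (- d_x u1 x y) by (pose proof (Hdiv x y Hy); lra).
    lra.
Qed.
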